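(* Let $p$ be a prime, let $(Y,d)$ be a metric space, and let $f:\mathbb{Q}_p\to Y$ be continuous, with set of periods $\mathfrak{P}_0(f)=\{h\in\mathbb{Q}_p : f(x+h)=f(x)\text{ for all }x\in\mathbb{Q}_p\}$. If $f$ is non-constant, then either $\mathfrak{P}_0(f)=\{0\}$ or $\mathfrak{P}_0(f)=p^N\mathbb{Z}_p$ for a certain $N\in\mathbb{Z}$. In particular, a continuous function $f:\mathbb{Q}_p\to Y$ is constant if and only if $\mathfrak{P}_0(f)$ contains an unbounded sequence (i.e. $f$ has an unbounded sequence of periods).
   Context: $\mathbb{Q}_p$ is the field of $p$-adic numbers with its $p$-adic absolute value $|\cdot|_p$ and the induced topology, and $\mathbb{Z}_p=\{x\in\mathbb{Q}_p:|x|_p\le 1\}$. ''Unbounded'' means unbounded with respect to $|\cdot|_p$. *)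

(* Defs.v *)
From HB Require Import structures.
From mathcomp Require Import all_boot all_order all_algebra generic_quotient ring_quotient.
From mathcomp Require Import boolp classical_sets functions reals topology.

Set Implicit Arguments.
Unset Strict Implicit.
Unset Printing Implicit Defensive.

Import Order.TTheory GRing.Theory Num.Theory.

Local Open Scope classical_set_scope.
Local Open Scope ring_scope.

(* The p-adic field is built as the ring of sequences of rationals that are
   Cauchy for the p-adic absolute value, modulo the ideal of null sequences.
   The construction makes sense for every p : nat (logn p is constantly 0 when
   p is not prime, and the absolute value is then the trivial one), so that no
   primality proof occurs in the types. The absolute value takes its values in
   rat, which contains all the powers of p. *)

Section RatAbs.
Variable p : nat.

Definition padic_val (x : rat) : int :=
  (logn p `|numq x|)%:Z - (logn p `|denq x|)%:Z.

Definition padic_absq (x : rat) : rat :=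
  if x == 0 then 0 else p%:R ^ (- padic_val x).

Let p_neq0_or : p%:R != 0 :> rat \/ forall x, padic_val x = 0.
Proof.
case: (boolP (prime p)) => pp.
  by left; rewrite pnatr_eq0 -lt0n prime_gt0.
by right=> x; rewrite /padic_val /logn (negbTE pp).
Qed.

Lemma padic_val_frac (a b : int) : a != 0 -> b != 0 ->
  padic_val (a%:~R / b%:~R) = (logn p `|a|)%:Z - (logn p `|b|)%:Z.
Proof.
move=> a0 b0; set x := a%:~R / b%:~R.
have b0' : b%:~R != 0 :> rat by rewrite intr_eq0.
have x0 : x != 0 by rewrite mulf_neq0 ?invr_eq0 ?intr_eq0.
have d0 : (denq x)%:~R != 0 :> rat by rewrite intr_eq0 denq_eq0.
have E : numq x * b = a * denq x.
  apply: (@intr_inj rat); rewrite !intrM.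
  by apply/eqP; rewrite -eqr_div // divq_num_den.
have /(congr1 (fun z : int => logn p `|z|%N)) := E.
rewrite !abszM !lognM ?absz_gt0 ?numq_eq0 ?denq_eq0 // => /(congr1 Posz).
rewrite /padic_val !PoszD => E'.
apply/eqP; rewrite subr_eq addrAC eq_sym subr_eq E' eq_sym; exact: eqxx.
Qed.

Lemma padic_valM x y : x != 0 -> y != 0 ->
  padic_val (x * y) = padic_val x + padic_val y.
Proof.
move=> x0 y0; rewrite -{1}(divq_num_den x) -{1}(divq_num_den y) mulf_div -!intrM.
rewrite padic_val_frac ?mulf_neq0 ?numq_eq0 ?denq_eq0 //.
rewrite !abszM !lognM ?absz_gt0 ?numq_eq0 ?denq_eq0 // !PoszD opprD /padic_val.
by rewrite addrACA.
Qed.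

Lemma padic_valD x y : x != 0 -> y != 0 -> x + y != 0 ->
  Num.min (padic_val x) (padic_val y) <= padic_val (x + y).
Proof.
move=> x0 y0 xy0.
case: (boolP (prime p)) => pp; last first.
  by rewrite /padic_val /logn (negbTE pp) subrr minxx.
set d : int := denq x * denq y.
have d0 : d != 0 by rewrite mulf_neq0 ?denq_eq0.
have d0' : d%:~R != 0 :> rat by rewrite intr_eq0.
pose a : int := numq x * denq y; pose b : int := numq y * denq x.
have dx0 : (denq x)%:~R != 0 :> rat by rewrite intr_eq0 denq_eq0.
have dy0 : (denq y)%:~R != 0 :> rat by rewrite intr_eq0 denq_eq0.
have Ex : x = a%:~R / d%:~R.
  by rewrite /a /d !intrM -mulf_div [X in _ * X]divff // mulr1 divq_num_den.
have Ey : y = b%:~R / d%:~R.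
  rewrite /b /d [denq x * _]mulrC !intrM -mulf_div [X in _ * X]divff // mulr1.
  by rewrite divq_num_den.
have Exy : x + y = (a + b)%:~R / d%:~R by rewrite {1}Ex {1}Ey -mulrDl -intrD.
have a0 : a != 0 by rewrite mulf_neq0 ?numq_eq0 ?denq_eq0.
have b0 : b != 0 by rewrite mulf_neq0 ?numq_eq0 ?denq_eq0.
have ab0 : a + b != 0.
  by apply: contra xy0; rewrite Exy => /eqP ->; rewrite mul0r.
rewrite Exy padic_val_frac // {1}Ex {1}Ey !padic_val_frac //.
set va := logn p `|a|; set vb := logn p `|b|.
have : (minn va vb <= logn p (absz (a + b)%R))%N.
  rewrite -pfactor_dvdn ?absz_gt0 //.
  suff : (Posz (p ^ minn va vb)%N %| a + b)%Z by [].
  by apply: rpredD; rewrite -[_ \in _]/(_ %| _)%N pfactor_dvdn ?absz_gt0 ?geq_minl ?geq_minr.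
rewrite geq_min ge_min !lerD2r !lez_nat => /orP[->//|->]; exact: orbT.
Qed.

Lemma padic_absq0 : padic_absq 0 = 0.
Proof. by rewrite /padic_absq eqxx. Qed.

Lemma padic_absq_gt0 x : (0 < padic_absq x) = (x != 0).
Proof.
rewrite /padic_absq; have [//|x0] := eqVneq x 0.
have [p0|->] := p_neq0_or; last by rewrite oppr0 expr0z.
by rewrite exprz_gt0 // lt_neqAle eq_sym p0 ler0n.
Qed.

Lemma padic_absq_eq0 x : (padic_absq x == 0) = (x == 0).
Proof.
have := padic_absq_gt0 x; have [->|x0] := eqVneq x 0; first by rewrite padic_absq0 eqxx.
by move/lt0r_neq0/negbTE.
Qed.

Lemma padic_absq_ge0 x : 0 <= padic_absq x.
Proof.
have [->|x0] := eqVneq x 0; first by rewrite padic_absq0.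
by rewrite ltW // padic_absq_gt0.
Qed.

Lemma padic_absqM x y : padic_absq (x * y) = padic_absq x * padic_absq y.
Proof.
have [->|x0] := eqVneq x 0; first by rewrite mul0r padic_absq0 mul0r.
have [->|y0] := eqVneq y 0; first by rewrite mulr0 padic_absq0 mulr0.
rewrite /padic_absq mulf_eq0 !(negbTE x0, negbTE y0) /= padic_valM // opprD.
case: p_neq0_or => [p0|v0]; first exact: expfzDr.
by rewrite !v0 subr0 oppr0 expr0z mulr1.
Qed.

Lemma padic_absq1 : padic_absq 1 = 1.
Proof.
have /mulfI : padic_absq 1 != 0 by rewrite padic_absq_eq0 oner_neq0.
by apply; rewrite -padic_absqM !mulr1.
Qed.

Lemma padic_absqN x : padic_absq (- x) = padic_absq x.
Proof.
rewrite /padic_absq oppr_eq0 /padic_val denqN numqN abszN //.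
Qed.

Lemma padic_absqB x y : padic_absq (x - y) = padic_absq (y - x).
Proof. by rewrite -padic_absqN opprB. Qed.

Lemma padic_absqV x : padic_absq x^-1 = (padic_absq x)^-1.
Proof.
have [->|x0] := eqVneq x 0; first by rewrite padic_absq0 !invr0 padic_absq0.
have /mulfI : padic_absq x != 0 by rewrite padic_absq_eq0.
by apply; rewrite -padic_absqM !divff ?padic_absq1 ?padic_absq_eq0.
Qed.

Lemma padic_absqD x y :
  padic_absq (x + y) <= Num.max (padic_absq x) (padic_absq y).
Proof.
have [->|x0] := eqVneq x 0; first by rewrite add0r le_max lexx orbT.
have [->|y0] := eqVneq y 0; first by rewrite addr0 le_max lexx.
have [->|xy0] := eqVneq (x + y) 0; first by rewrite padic_absq0 le_max padic_absq_ge0.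
have := padic_valD x0 y0 xy0.
rewrite /padic_absq (negbTE x0) (negbTE y0) (negbTE xy0).
case: (boolP (prime p)) => pp; last first.
  by rewrite /padic_val /logn (negbTE pp) subrr oppr0 expr0z maxxx.
have p1 : 1 <= p%:R :> rat by rewrite ler1n prime_gt0.
rewrite ge_min le_max => /orP[h|h]; apply/orP; [left|right];
  by rewrite ler_weXz2l // lerN2.
Qed.

Lemma padic_absqD_lt e x y : padic_absq x < e -> padic_absq y < e ->
  padic_absq (x + y) < e.
Proof. by move=> xe ye; rewrite (le_lt_trans (padic_absqD x y)) // gt_max xe. Qed.

Lemma padic_absq_isosceles x y : padic_absq y < padic_absq x ->
  padic_absq (x + y) = padic_absq x.
Proof.
move=> yx; apply/eqP; rewrite eq_le; apply/andP; split.
  by rewrite (le_trans (padic_absqD x y)) // ge_max lexx ltW.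
rewrite leNgt; apply/negP => h.
by have := padic_absqD_lt h (_ : padic_absq (- y) < _); rewrite padic_absqN addrK ltxx => /(_ yx).
Qed.

End RatAbs.

Section CauchySequences.
Variable p : nat.

Definition is_padic_cauchy : pred (nat -> rat) := fun u =>
  `[< forall e : rat, 0 < e -> exists N, forall m n,
        (N <= m)%N -> (N <= n)%N -> padic_absq p (u m - u n) < e >].

Lemma padic_cauchy_bounded u : u \in is_padic_cauchy ->
  exists2 M, 0 < M & forall n, padic_absq p (u n) <= M.
Proof.
move=> /asboolP /(_ 1 ltr01) [N uN].
have [M0 HM0] : exists M0, forall n, (n <= N)%N -> padic_absq p (u n) <= M0.
  elim: N {uN} => [|N [M HM]].
    by exists (padic_absq p (u 0%N)) => n; rewrite leqn0 => /eqP ->.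
  exists (Num.max M (padic_absq p (u N.+1))) => n.
  rewrite leq_eqVlt le_max => /predU1P[->|/HM ->//]; by rewrite lexx orbT.
exists (Num.max 1 M0) => [|n]; first by rewrite lt_max ltr01.
have [/HM0 h|/ltnW h] := leqP n N; first by rewrite le_max h orbT.
rewrite -[u n](subrK (u N)); apply: (le_trans (padic_absqD _ _ _)).
rewrite ge_max !le_max (ltW (uN _ _ h (leqnn _))) /= HM0 //; exact: orbT.
Qed.

Fact padic_cauchy_subring : subring_closed is_padic_cauchy.
Proof.
split.
- apply/asboolP => e e0; exists 0%N => m n _ _.
  by rewrite /= subrr padic_absq0.
- move=> u v /asboolP cu /asboolP cv; apply/asboolP => e e0.
  have [[M uM] [N vN]] := (cu e e0, cv e e0).
  exists (maxn M N) => m n; rewrite !geq_max => /andP[Mm Nm] /andP[Mn Nn].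
  rewrite (_ : (u - v) m - (u - v) n = (u m - u n) + - (v m - v n)).
    by apply: padic_absqD_lt; rewrite ?padic_absqN; [exact: uM|exact: vN].
  by rewrite /= !opprD !opprK addrACA.
- move=> u v cu cv; apply/asboolP => e e0.
  have [A A0 uA] := padic_cauchy_bounded cu.
  have [B B0 vB] := padic_cauchy_bounded cv.
  move: cu cv => /asboolP cu /asboolP cv.
  have [M uM] := cu (e / B) (divr_gt0 e0 B0).
  have [N vN] := cv (e / A) (divr_gt0 e0 A0).
  exists (maxn M N) => m n; rewrite !geq_max => /andP[Mm Nm] /andP[Mn Nn].
  rewrite (_ : (u * v) m - (u * v) n = (u m - u n) * v m + u n * (v m - v n)).
    apply: padic_absqD_lt; rewrite padic_absqM.
      apply: (le_lt_trans (y := padic_absq p (u m - u n) * B)).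
        by rewrite ler_wpM2l ?padic_absq_ge0.
      by rewrite -ltr_pdivlMr // uM.
    apply: (le_lt_trans (y := A * padic_absq p (v m - v n))).
      by rewrite ler_wpM2r ?padic_absq_ge0.
    by rewrite mulrC -ltr_pdivlMr // vN.
  by rewrite mulrBl mulrBr addrA subrK.
Qed.

HB.instance Definition _ :=
  GRing.isSubringClosed.Build (nat -> rat) is_padic_cauchy padic_cauchy_subring.

Record padic_cauchy := PadicCauchy {
  padic_cauchy_seq :> nat -> rat;
  _ : padic_cauchy_seq \in is_padic_cauchy
}.

HB.instance Definition _ := [isSub for padic_cauchy_seq].
HB.instance Definition _ := [Choice of padic_cauchy by <:].
HB.instance Definition _ := [SubChoice_isSubComNzRing of padic_cauchy by <:].

Definition padic_null : pred padic_cauchy := fun u =>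
  `[< forall e : rat, 0 < e -> exists N, forall n,
        (N <= n)%N -> padic_absq p (u n) < e >].

Fact padic_null_idealr : idealr_closed padic_null.
Proof.
split.
- by apply/asboolP => e e0; exists 0%N => n _; rewrite /= padic_absq0.
- apply/negP => /asboolP /(_ 1 ltr01) [N /(_ N (leqnn N))].
  by rewrite /= padic_absq1 ltxx.
- move=> a u v /asboolP u0 /asboolP v0; apply/asboolP => e e0.
  have [A A0 aA] := padic_cauchy_bounded (valP a).
  have [M uM] := u0 (e / A) (divr_gt0 e0 A0).
  have [N vN] := v0 e e0.
  exists (maxn M N) => n; rewrite geq_max => /andP[Mn Nn].
  rewrite /=; apply: padic_absqD_lt; last exact: vN.
  rewrite padic_absqM (le_lt_trans (y := A * padic_absq p (u n))) //.
    by rewrite ler_wpM2r ?padic_absq_ge0 //; exact: aA.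
  by rewrite mulrC -ltr_pdivlMr // uM.
Qed.

HB.instance Definition _ :=
  isIdealr.Build padic_cauchy padic_null padic_null_idealr.

End CauchySequences.

Local Open Scope quotient_scope.

Definition padic (p : nat) : Type :=
  @Quotient.quot (padic_cauchy p) (@padic_null p : idealr (padic_cauchy p)).

HB.instance Definition _ p := GRing.ComNzRing.on (padic p).
HB.instance Definition _ p := EqQuotient.on (padic p).

Section PadicField.
Variable p : nat.
Implicit Types (x y z : padic p) (u v : padic_cauchy p).

Definition padic_class u : padic p := \pi_(padic p) u.

Fact padic_class_zmod_morphism : zmod_morphism padic_class.
Proof. by move=> u v; exact: (rmorphB (\pi_(padic p))). Qed.

Fact padic_class_monoid_morphism : monoid_morphism padic_class.
Proof.
split; first exact: (rmorph1 (\pi_(padic p))).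
by move=> u v; exact: (rmorphM (\pi_(padic p))).
Qed.

HB.instance Definition _ :=
  GRing.isZmodMorphism.Build (padic_cauchy p) (padic p) padic_class
    padic_class_zmod_morphism.
HB.instance Definition _ :=
  GRing.isMonoidMorphism.Build (padic_cauchy p) (padic p) padic_class
    padic_class_monoid_morphism.

Lemma padic_reprK x : padic_class (repr x) = x.
Proof. exact: reprK. Qed.

Lemma padic_class_eqE u v :
  (padic_class u == padic_class v) = (u - v \in @padic_null p).
Proof. by rewrite Quotient.idealrBE. Qed.

Lemma padic_class_eq0 u : (padic_class u == 0) = (u \in @padic_null p).
Proof. by rewrite -[0](rmorph0 padic_class) padic_class_eqE subr0. Qed.

Lemma padic_cauchy_stationary u : u \notin @padic_null p ->
  exists N, forall n, (N <= n)%N -> padic_absq p (u n) = padic_absq p (u N) /\ u n != 0.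
Proof.
move=> /asboolPn /existsNP[e /not_implyP[e0 nu]].
have /asboolP /(_ e e0) [N uN] := valP u.
have [M NM uM] : exists2 M, (N <= M)%N & e <= padic_absq p (u M).
  apply: contrapT => h; apply: nu; exists N => n Nn; rewrite ltNge; apply/negP => en.
  by apply: h; exists n.
exists M => n Mn.
have E : padic_absq p (u n) = padic_absq p (u M).
  rewrite -[u n](subrK (u M)) addrC padic_absq_isosceles //.
  by rewrite (lt_le_trans _ uM) // uN // (leq_trans NM).
by split=> //; rewrite -(padic_absq_gt0 p) E (lt_le_trans e0).
Qed.

Definition padic_inv x : padic p :=
  if x == 0 then 0 else
  padic_class (insubd (0 : padic_cauchy p) (fun n => (repr x n)^-1)).

Fact padic_mulVr x : x != 0 -> padic_inv x * x = 1.
Proof.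
move=> x0; rewrite /padic_inv (negbTE x0) -{2}[x]padic_reprK.
have : repr x \notin @padic_null p by rewrite -padic_class_eq0 padic_reprK.
move=> /padic_cauchy_stationary; set u := repr x => -[N uN].
have cN : 0 < padic_absq p (u N) by rewrite padic_absq_gt0 (uN _ (leqnn _)).2.
have cV : (fun n => (u n)^-1) \in is_padic_cauchy p.
  apply/asboolP => e e0.
  have /asboolP /(_ (e * padic_absq p (u N) ^+ 2)) := valP u.
  case=> [|M uM]; first by rewrite mulr_gt0 ?exprn_gt0.
  exists (maxn M N) => m n; rewrite !geq_max => /andP[Mm Nm] /andP[Mn Nn].
  have [[Em um] [En un]] := (uN m Nm, uN n Nn).
  rewrite (_ : _ - _ = (u n - u m) * ((u m)^-1 * (u n)^-1)).
    rewrite !padic_absqM !padic_absqV Em En -invfM -expr2.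
    by rewrite ltr_pdivrMr ?exprn_gt0 // uM.
  by rewrite mulrBl mulrCA divff // mulr1 mulrA divff // mul1r.
rewrite -(rmorphM padic_class) -(rmorph1 padic_class).
apply/eqP; rewrite padic_class_eqE; apply/asboolP => e e0.
exists N => n Nn.
rewrite (_ : insubd _ _ = PadicCauchy cV); last first.
  by apply: val_inj; rewrite val_insubd cV.
by rewrite -[X in padic_absq p X]/((u n)^-1 * u n - 1) mulVf ?(uN n Nn).2 // subrr padic_absq0.
Qed.

Fact padic_inv0 : padic_inv 0 = 0.
Proof. by rewrite /padic_inv eqxx. Qed.

HB.instance Definition _ :=
  GRing.ComNzRing_isField.Build (padic p) padic_mulVr padic_inv0.

(* The sequence of the absolute values of a Cauchy sequence is eventually
   constant unless the sequence is null, in which case xget returns 0. *)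
Definition padic_abs x : rat :=
  xget 0 [set c | exists N, forall n, (N <= n)%N -> padic_absq p (repr x n) = c].

Lemma padic_abs_stationary u N c :
  (forall n, (N <= n)%N -> padic_absq p (u n) = c) ->
  padic_abs (padic_class u) = c.
Proof.
move=> uN; rewrite /padic_abs; set v := repr _.
have uv : u - v \in @padic_null p.
  by rewrite -padic_class_eqE padic_reprK.
have uniq c1 c2 : (exists N, forall n, (N <= n)%N -> padic_absq p (v n) = c1) ->
    (exists N, forall n, (N <= n)%N -> padic_absq p (v n) = c2) -> c1 = c2.
  move=> [N1 v1] [N2 v2]; rewrite -(v1 (maxn N1 N2)) ?leq_maxl //.
  by rewrite v2 ?leq_maxr.
have c0 : 0 <= c by rewrite -(uN N (leqnn _)) padic_absq_ge0.
have [c_gt0|c_le0] := ltP 0 c.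
  have vc : exists N, forall n, (N <= n)%N -> padic_absq p (v n) = c.
    have /asboolP /(_ c c_gt0) [M uvM] := uv.
    exists (maxn M N) => n; rewrite geq_max => /andP[Mn Nn].
    rewrite -(uN n Nn) -[v n](subrK (u n)) addrC padic_absq_isosceles //.
    by rewrite uN // padic_absqB uvM.
  by case: xgetP => [d _ vd|/(_ c)/(_ vc)//]; exact: uniq vd vc.
have {c_le0 c0}cE : c = 0 by apply/eqP; rewrite eq_le c_le0 c0.
case: xgetP => [d _ [M vM]|//]; rewrite cE; apply/eqP; rewrite eq_le.
rewrite -{2}(vM M (leqnn _)) padic_absq_ge0 andbT leNgt; apply/negP => d0.
have /asboolP /(_ d d0) [K uvK] := uv.
pose n := maxn K (maxn M N).
have Kn : (K <= n)%N by rewrite leq_maxl.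
have Mn : (M <= n)%N by rewrite /n maxnCA leq_maxl.
have Nn : (N <= n)%N by rewrite /n maxnA leq_maxr.
have un : u n = 0 by apply/eqP; rewrite -(padic_absq_eq0 p) uN // cE.
have : padic_absq p (u n - v n) < d := uvK n Kn.
by rewrite un add0r padic_absqN vM // ltxx.
Qed.

Lemma padic_abs0 : padic_abs 0 = 0.
Proof.
rewrite -(rmorph0 padic_class); apply: (@padic_abs_stationary _ 0%N) => n _.
by rewrite /= padic_absq0.
Qed.

Lemma padic_absE x : x != 0 -> 0 < padic_abs x /\
  exists N, forall n, (N <= n)%N -> padic_absq p (repr x n) = padic_abs x.
Proof.
move=> x0; have : repr x \notin @padic_null p by rewrite -padic_class_eq0 padic_reprK.
move=> /padic_cauchy_stationary[N xN].
have := @padic_abs_stationary (repr x) N _ (fun n Nn => (xN n Nn).1).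
rewrite padic_reprK => ->; split; first by rewrite padic_absq_gt0 (xN _ (leqnn _)).2.
by exists N => n /xN[].
Qed.

Lemma padic_abs_ge0 x : 0 <= padic_abs x.
Proof.
have [->|/padic_absE[/ltW//]] := eqVneq x 0; by rewrite padic_abs0.
Qed.

Lemma padic_abs_eq0 x : (padic_abs x == 0) = (x == 0).
Proof.
have [->|/padic_absE[/lt0r_neq0/negbTE//]] := eqVneq x 0; by rewrite padic_abs0 eqxx.
Qed.

Lemma padic_absM x y : padic_abs (x * y) = padic_abs x * padic_abs y.
Proof.
have [->|/padic_absE[_ [N xN]]] := eqVneq x 0; first by rewrite mul0r padic_abs0 mul0r.
have [->|/padic_absE[_ [M yM]]] := eqVneq y 0; first by rewrite mulr0 padic_abs0 mulr0.
rewrite -{1}[x]padic_reprK -{1}[y]padic_reprK -(rmorphM padic_class).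
apply: (@padic_abs_stationary _ (maxn N M)) => n.
by rewrite geq_max => /andP[Nn Mn]; rewrite /= padic_absqM xN // yM.
Qed.

Lemma padic_absN x : padic_abs (- x) = padic_abs x.
Proof.
have [->|/padic_absE[_ [N xN]]] := eqVneq x 0; first by rewrite oppr0.
rewrite -{1}[x]padic_reprK -(rmorphN padic_class).
by apply: (@padic_abs_stationary _ N) => n Nn; rewrite /= padic_absqN xN.
Qed.

Lemma padic_absD x y : padic_abs (x + y) <= Num.max (padic_abs x) (padic_abs y).
Proof.
have [->|x0] := eqVneq x 0; first by rewrite add0r le_max lexx orbT.
have [->|y0] := eqVneq y 0; first by rewrite addr0 le_max lexx.
have [_ [N xN]] := padic_absE x0; have [_ [M yM]] := padic_absE y0.
have [->|xy0] := eqVneq (x + y) 0; first by rewrite padic_abs0 le_max padic_abs_ge0.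
have xyE : padic_class (repr x + repr y) = x + y.
  by rewrite (rmorphD padic_class); congr (_ + _); exact: padic_reprK.
have : repr x + repr y \notin @padic_null p by rewrite -padic_class_eq0 xyE.
move=> /padic_cauchy_stationary[K xyK].
have := @padic_abs_stationary (repr x + repr y) K _ (fun n Kn => (xyK n Kn).1).
rewrite xyE => ->.
pose n := maxn K (maxn M N).
have Kn : (K <= n)%N by rewrite leq_maxl.
have Mn : (M <= n)%N by rewrite /n maxnCA leq_maxl.
have Nn : (N <= n)%N by rewrite /n maxnA leq_maxr.
by rewrite -(xyK n Kn).1 -(xN n Nn) -(yM n Mn) padic_absqD.
Qed.

Fact padic_cauchy_cst (q : rat) : (fun=> q) \in is_padic_cauchy p.
Proof. by apply/asboolP => e e0; exists 0%N => m n _ _; rewrite subrr padic_absq0. Qed.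

Lemma padic_ratrE (q : rat) : ratr q = padic_class (PadicCauchy (padic_cauchy_cst q)).
Proof.
have intE (m : int) : m%:~R = padic_class (PadicCauchy (padic_cauchy_cst m%:~R)).
  rewrite -(rmorph_int padic_class); congr padic_class.
  apply: val_inj; rewrite (rmorph_int \val); apply/funext => n /=.
  have natE k : (k%:R : nat -> rat) n = k%:R.
    by elim: k => // k IH; rewrite !mulrS -IH.
  by case: m => k; rewrite ?NegzE ?mulrNz -!pmulrn -natE.
have d0 : (denq q)%:~R != 0 :> padic p.
  rewrite intE padic_class_eq0; apply/negP => /asboolP.
  have dq0 : (denq q)%:~R != 0 :> rat by rewrite intr_eq0 denq_eq0.
  move=> /(_ (padic_absq p (denq q)%:~R)); rewrite padic_absq_gt0 => /(_ dq0)[N].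
  by move=> /(_ N (leqnn N)); rewrite /= ltxx.
apply: (mulIf d0); rewrite /ratr divfK // !intE -(rmorphM padic_class).
by congr padic_class; apply: val_inj; apply/funext => n /=; rewrite numqE.
Qed.

Lemma padic_abs_ratr (q : rat) : padic_abs (ratr q) = padic_absq p q.
Proof. by rewrite padic_ratrE (@padic_abs_stationary _ 0%N (padic_absq p q)). Qed.

Lemma padic_ratrB (q r : rat) : ratr (q - r) = ratr q - ratr r :> padic p.
Proof.
rewrite !padic_ratrE -(rmorphB padic_class); congr padic_class.
exact: val_inj.
Qed.

Lemma padic_abs_class_le u N e :
  (forall n, (N <= n)%N -> padic_absq p (u n) <= e) -> padic_abs (padic_class u) <= e.
Proof.
move=> uN; have [u0|/padic_cauchy_stationary[M uM]] := boolP (u \in @padic_null p).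
  move: (u0); rewrite -padic_class_eq0 => /eqP ->; rewrite padic_abs0.
  by rewrite (le_trans _ (uN _ (leqnn N))) // padic_absq_ge0.
rewrite (padic_abs_stationary (fun n Mn => (uM n Mn).1)).
by rewrite -(uM _ (leq_maxl M N)).1 uN // leq_maxr.
Qed.

Lemma padic_class_cvg u e : 0 < e -> exists N, forall n, (N <= n)%N ->
  padic_abs (padic_class u - ratr (u n)) < e.
Proof.
move=> e0; have e20 : 0 < e / 2%:R by rewrite divr_gt0.
have /asboolP /(_ _ e20)[N uN] := valP u.
exists N => n Nn; apply: (@le_lt_trans _ _ (e / 2%:R)); last first.
  by rewrite ltr_pdivrMr // ltr_pMr // ltr1n.
rewrite padic_ratrE -(rmorphB padic_class); apply: (@padic_abs_class_le _ N) => m Nm.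
exact/ltW/uN.
Qed.

Lemma padic_dense x e : 0 < e -> exists q : rat, padic_abs (x - ratr q) < e.
Proof.
move=> /(@padic_class_cvg (repr x))[N /(_ N (leqnn N))].
by rewrite padic_reprK; exists (repr x N).
Qed.

Lemma padic_absD_lt e x y : padic_abs x < e -> padic_abs y < e -> padic_abs (x + y) < e.
Proof. by move=> xe ye; rewrite (le_lt_trans (padic_absD x y)) // gt_max xe. Qed.

Lemma padic_complete (s : nat -> padic p) :
  (forall e, 0 < e -> exists N, forall m n, (N <= m)%N -> (N <= n)%N ->
    padic_abs (s m - s n) < e) ->
  exists l, forall e, 0 < e -> exists N, forall n, (N <= n)%N ->
    padic_abs (s n - l) < e.
Proof.
move=> sc.
have /choice[q sq] n : exists q : rat, padic_abs (s n - ratr q) < n.+1%:R^-1.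
  by apply: padic_dense; rewrite invr_gt0.
have sqe e : 0 < e -> exists N, forall n, (N <= n)%N -> padic_abs (s n - ratr (q n)) < e.
  move=> e0; exists (Num.truncn e^-1) => n Nn; apply: (lt_le_trans (sq n)).
  rewrite -[e]invrK lef_pV2 ?posrE ?invr_gt0 //.
  by rewrite ltW // (lt_le_trans (truncnS_gt _)) // ler_nat.
have qc : q \in is_padic_cauchy p.
  apply/asboolP => e e0; have [N sN] := sc e e0; have [M qM] := sqe e e0.
  exists (maxn N M) => m n; rewrite !geq_max => /andP[Nm Mm] /andP[Nn Mn].
  rewrite -padic_abs_ratr padic_ratrB.
  rewrite (_ : _ - _ = - (s m - ratr (q m)) + ((s m - s n) + (s n - ratr (q n)))).
    apply: padic_absD_lt; first by rewrite padic_absN qM.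
    by apply: padic_absD_lt; [exact: sN|exact: qM].
  by rewrite subrKA opprB subrKA.
exists (padic_class (PadicCauchy qc)) => e e0.
have [N qN] := @padic_class_cvg (PadicCauchy qc) e e0; have [M qM] := sqe e e0.
exists (maxn N M) => n; rewrite geq_max => /andP[Nn Mn].
rewrite -(subrKA (ratr (q n))) padic_absD_lt ?qM // -padic_absN opprB.
exact: qN.
Qed.

Definition padic_dist x y : rat := padic_abs (x - y).

Fact padic_distxx x : padic_dist x x = 0.
Proof. by rewrite /padic_dist subrr padic_abs0. Qed.

Fact padic_dist_eq0 x y : padic_dist x y = 0 -> x = y.
Proof. by move/eqP; rewrite padic_abs_eq0 subr_eq0 => /eqP. Qed.

Fact padic_dist_sym x y : padic_dist x y = padic_dist y x.
Proof. by rewrite /padic_dist -padic_absN opprB. Qed.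

Fact padic_dist_triangle y x z : padic_dist x z <= padic_dist x y + padic_dist y z.
Proof.
rewrite /padic_dist -[x - z](subrKA y); apply: (le_trans (padic_absD _ _)).
by rewrite ge_max lerDl lerDr !padic_abs_ge0.
Qed.

HB.instance Definition _ := isMetric.Build rat (padic p)
  padic_distxx padic_dist_eq0 padic_dist_sym padic_dist_triangle.

End PadicField.

Definition padic_integers (p : nat) : set (padic p) :=
  [set x | padic_abs x <= 1].
Arguments padic_integers p : clear implicits.

Definition periods (p : nat) (Y : Type) (f : padic p -> Y) : set (padic p) :=
  [set h | forall x, f (x + h) = f x].

Definition padic_bounded (p : nat) (A : set (padic p)) : Prop :=
  exists M : rat, forall x, A x -> padic_abs x <= M.

Definition is_constant (T U : Type) (f : T -> U) : Prop :=
  exists c, forall x, f x = c.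

(* Main.v *)
Require Import Defs.
From mathcomp Require Import all_boot all_order all_algebra.
From mathcomp Require Import boolp classical_sets reals topology.

Set Implicit Arguments.
Unset Strict Implicit.
Unset Printing Implicit Defensive.

Import Order.TTheory GRing.Theory Num.Theory.

Local Open Scope classical_set_scope.
Local Open Scope ring_scope.

(* Integer multiples of a period are periods and the integers are dense in
   Z_p, so by continuity the periods form a Z_p-submodule of Q_p: together with
   a nonzero period h they contain the whole ball of radius |h|. Either the
   radii of these balls are unbounded and f is constant, or the smallest N with
   p^N a period gives all of them. *)

Lemma natr_gt_rat (x : rat) : exists n : nat, x < n%:R.
Proof. by exists (Num.truncn x).+1; exact: truncnS_gt. Qed.

Section PadicValues.
Variables (p : nat) (p_prime : prime p).

Lemma natp_neq0 : p%:R != 0 :> rat.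
Proof. by rewrite pnatr_eq0 -lt0n prime_gt0. Qed.

Lemma natp_gt1 : 1 < p%:R :> rat.
Proof. by rewrite ltr1n prime_gt1. Qed.

Lemma expz_natp_gt (x : rat) : exists k : nat, x < p%:R ^ k%:Z.
Proof.
have [k xk] := natr_gt_rat x; exists k; apply: (lt_trans xk).
by rewrite -exprnP -natrX ltr_nat ltn_expl // prime_gt1.
Qed.

Lemma padic_absq_intr_le1 (m : int) : padic_absq p m%:~R <= 1.
Proof.
rewrite /padic_absq; case: ifP => // m0.
have {m0}m0 : m != 0 by rewrite -(intr_eq0 rat) m0.
rewrite -[m%:~R]divr1 -[1 in X in padic_val _ X]/(1%:~R) padic_val_frac //.
rewrite logn1 subr0 -(expr0z (p%:R : rat)) ler_eXz2l ?natp_gt1 //.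
by rewrite oppr_le0.
Qed.

Lemma padic_absq_natp : padic_absq p p%:R = p%:R^-1.
Proof.
rewrite /padic_absq (negbTE natp_neq0) -[X in padic_val _ X]divr1.
rewrite -[p%:R]/((p%:Z)%:~R) -[1 in X in padic_val _ X]/(1%:~R) padic_val_frac //.
  by rewrite /= logn1 subr0 -[p in logn _ p]expn1 pfactorK.
by rewrite -lt0n prime_gt0.
Qed.

(** In lowest terms, [p] dividing the denominator would force [p] to divide the numerator as well,
    because the valuation is nonnegative. *)
Lemma padic_absq_le1_coprime (q : rat) :
  padic_absq p q <= 1 -> coprime `|denq q| p.
Proof.
rewrite coprime_sym prime_coprime // /padic_absq; case: ifP => [/eqP-> _|q0].
  by rewrite dvdn1 neq_ltn prime_gt1 ?orbT.
rewrite -(expr0z (p%:R : rat)) ler_eXz2l ?natp_gt1 // oppr_le0 subr_ge0.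
rewrite lez_nat => le_den_num; apply/negP => p_den.
have p_num : (p %| `|numq q|)%N.
  rewrite -[p]expn1 pfactor_dvdn ?absz_gt0 ?numq_eq0 ?q0 //.
  apply: leq_trans le_den_num.
  by rewrite -pfactor_dvdn ?absz_gt0 ?denq_eq0 // expn1.
have : (p %| gcdn `|numq q| `|denq q|)%N by rewrite dvdn_gcd p_num.
rewrite (eqP (coprime_num_den q)) dvdn1 => /eqP p1.
by move: p_prime; rewrite p1.
Qed.

Lemma rat_int_approx (q e : rat) : padic_absq p q <= 1 -> 0 < e ->
  exists m : int, padic_absq p (q - m%:~R) < e.
Proof.
move=> q1 e0; have [k ek] := expz_natp_gt e^-1.
have [u [v uv]] := Bezoutz (denq q) (p ^ k)%:Z.
have {}uv : u%:~R * (denq q)%:~R + v%:~R * p%:R ^+ k = 1 :> rat.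
  rewrite -natrX -[(p ^ k)%:R]/((p ^ k)%:Z%:~R) -!intrM -intrD uv /gcdz.
  by rewrite (eqP (coprimeXr k (padic_absq_le1_coprime q1))).
(* By the Bezout relation, [u] inverts the denominator modulo [p ^ k], so the error is
   [q * v * p ^ k], where [q] and [v] have absolute value at most 1. *)
exists (u * numq q).
have -> : q - (u * numq q)%:~R = q * (v%:~R * p%:R ^+ k).
  rewrite intrM numqE mulrCA -{1}[q]mulr1 -mulrBr; congr (_ * _).
  by apply/eqP; rewrite subr_eq addrC uv.
have pk : padic_absq p (p%:R ^+ k) < e.
  have -> : padic_absq p (p%:R ^+ k) = (p%:R ^ k%:Z)^-1.
    rewrite -exprnP; elim: k {ek uv} => [|k IH]; first by rewrite padic_absq1 invr1.
    by rewrite !exprS padic_absqM IH padic_absq_natp invfM.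
  by rewrite -[e]invrK ltf_pV2 ?posrE ?invr_gt0 // exprz_gt0 // (lt_trans _ natp_gt1).
apply: le_lt_trans pk; rewrite !padic_absqM -[leRHS]mul1r mulrA.
rewrite ler_wpM2r ?padic_absq_ge0 // mulr_ile1 ?padic_absq_ge0 //.
exact: padic_absq_intr_le1.
Qed.

Lemma padic_int_approx (z : padic p) (e : rat) : padic_abs z <= 1 -> 0 < e ->
  exists m : int, padic_abs (z - m%:~R) < e.
Proof.
(* The cap at 1 keeps the rational approximation [q] of [z] in the unit ball, by the ultrametric
   inequality. *)
move=> z1 e0; have e10 : 0 < Num.min e 1 by rewrite lt_min e0 ltr01.
have [q] := padic_dense z e10; rewrite lt_min => /andP[zqe zq1].
have q1 : padic_absq p q <= 1.
  rewrite -padic_abs_ratr -[ratr q](subKr z); apply: le_trans (padic_absD _ _) _.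
  by rewrite ge_max z1 padic_absN ltW.
have [m qm] := rat_int_approx q1 e0; exists m.
rewrite -(subrKA (ratr q)) padic_absD_lt //.
by rewrite -[m%:~R](ratr_int _ m) -padic_ratrB padic_abs_ratr.
Qed.

Lemma padic_abs_expz_natp (N : int) : padic_abs (p%:R ^ N : padic p) = p%:R ^ (- N).
Proof.
have abs1 : padic_abs (1 : padic p) = 1.
  have <- : ratr 1 = 1 :> padic p by exact: (ratr_nat _ 1).
  by rewrite padic_abs_ratr padic_absq1.
have absX k : padic_abs (p%:R ^+ k : padic p) = p%:R ^- k.
  elim: k => [|k IH]; first by rewrite !expr0 invr1.
  rewrite !exprS padic_absM IH -(ratr_nat (padic p) p) padic_abs_ratr.
  by rewrite padic_absq_natp invfM.
have absV (x : padic p) : padic_abs x^-1 = (padic_abs x)^-1.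
  have [->|x0] := eqVneq x 0; first by rewrite invr0 padic_abs0 invr0.
  have ax0 : padic_abs x != 0 by rewrite padic_abs_eq0.
  by apply: (mulfI ax0); rewrite -padic_absM !divff.
case: N => k; first by rewrite -exprnP absX exprnN.
by rewrite NegzE opprK -exprnN absV absX invrK.
Qed.

(** The absolute value is already attained by a rational term of a representing Cauchy sequence.
    This discreteness is what makes a largest ball of periods possible. *)
Lemma padic_abs_eq_expz (x : padic p) : x != 0 ->
  exists v : int, padic_abs x = p%:R ^ v.
Proof.
move=> /padic_absE[x_gt0 [N xN]]; rewrite -(xN N (leqnn N)).
have : 0 < padic_absq p (repr x N) by rewrite xN.
rewrite padic_absq_gt0 /padic_absq => /negbTE ->.
by exists (- padic_val p (repr x N)).
Qed.

End PadicValues.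

Section Periods.
Variables (R : realType) (p : nat) (p_prime : prime p).
Variables (Y : metricType R) (f : padic p -> Y) (f_cont : continuous f).

Lemma periods_mulz (h : padic p) (m : int) : periods f h -> periods f (h *~ m).
Proof.
move=> ph.
have pn n x : f (x + h *+ n) = f x.
  elim: n x => [|n IH] x; first by rewrite mulr0n addr0.
  by rewrite mulrS addrA IH ph.
case: m => n x; first exact: pn.
(* A negative multiple is handled by applying [pn] at the translated point. *)
by rewrite NegzE mulrNz -[in RHS](subrK (h *+ n.+1) x) pn.
Qed.

(** If [f (x + h)] and [f x] differed, the ball around [f (x + h)] with their distance as radius
    would miss [f x]; yet it contains [f (x + k) = f x] for any period [k] close enough to [h]. *)
Lemma periods_closed (h : padic p) :
  (forall e, 0 < e -> exists2 k, periods f k & padic_abs (h - k) < e) ->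
  periods f h.
Proof.
move=> approx x; apply/eqP/negPn/negP => neq.
have d0 : 0 < mdist (f (x + h)) (f x) by rewrite mdist_gt0.
have /= := f_cont (nbhsx_ballx (f (x + h)) _ d0).
rewrite -nbhs_ballE => -[e /= e0 /= sub].
have [k pk hk] := approx e e0.
have /sub : ball (x + h) e (x + k).
  by rewrite ballEmdist /= /mdist /= /padic_dist opprD addrACA subrr add0r.
by rewrite /= pk ballEmdist /= ltxx.
Qed.

Lemma periods_abs_le (h x : padic p) :
  periods f h -> padic_abs x <= padic_abs h -> periods f x.
Proof.
move=> ph xh; have [h0|h0] := eqVneq h 0.
  suff -> : x = 0 by move=> y; rewrite addr0.
  by apply/eqP; rewrite -padic_abs_eq0 eq_le padic_abs_ge0 -(padic_abs0 p) -h0 xh.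
have ah0 : 0 < padic_abs h by case: (padic_absE h0).
have z1 : padic_abs (x / h) <= 1.
  by rewrite -(ler_pM2r ah0) -padic_absM divfK // mul1r.
apply: periods_closed => e e0.
(* An error below [e / padic_abs h] on [x / h] becomes one below [e] on [x] after multiplication by
   [h]. *)
have [m zm] := padic_int_approx p_prime z1 (divr_gt0 e0 ah0).
exists (h *~ m); first exact: periods_mulz.
rewrite -mulrzr -{1}(divfK h0 x) [_ * h]mulrC -mulrBr padic_absM.
by rewrite mulrC -ltr_pdivlMr.
Qed.

Lemma unbounded_periods_constant :
  (forall M : rat, exists2 h, periods f h & M < padic_abs h) -> is_constant f.
Proof.
move=> unb; exists (f 0) => x; have [h ph xh] := unb (padic_abs x).
by rewrite -(periods_abs_le ph (ltW xh) 0) add0r.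
Qed.

Lemma periods_ball (h : padic p) : ~ is_constant f -> periods f h -> h != 0 ->
  exists N : int,
    periods f = [set (p%:R : padic p) ^ N * z | z in padic_integers p].
Proof.
move=> ncst ph h0.
have [M bound] : exists M : rat, forall k, periods f k -> padic_abs k <= M.
  apply: contrapT => nb; apply/ncst/unbounded_periods_constant => M.
  apply: contrapT => nM; apply: nb; exists M => k pk.
  by rewrite leNgt; apply/negP => Mk; apply: nM; exists k.
have [K MK] := expz_natp_gt p_prime M.
have [v hv] := padic_abs_eq_expz h0.
(* Since [M < p ^ K], no exponent at or below [-K] gives a period. Shifting by [K] thus turns the
   search for the least exponent into one over [nat]. *)
pose P (n : nat) := `[< periods f (p%:R ^ (n%:Z - K%:Z)) >].
have exP : exists n, P n.
  (* The shifted exponent is the absolute value of [v], and [p] to that power is no larger than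
     [h]. *)
  exists (K + `|v|)%N; apply/asboolP; apply: (periods_abs_le ph).
  rewrite padic_abs_expz_natp // hv ler_eXz2l ?natp_gt1 //.
  by rewrite PoszD addrAC subrr add0r lerNl abszE -normrN ler_norm.
case: (ex_minnP exP) => n /asboolP pn n_min; exists (n%:Z - K%:Z).
(* Positivity makes [n.-1] a genuine predecessor in the minimality argument below. *)
have n_gt0 : (0 < n)%N.
  rewrite lt0n; apply/negP => /eqP n0; have := bound _ pn.
  by rewrite padic_abs_expz_natp // n0 sub0r opprK leNgt MK.
have pN0 : p%:R ^ (n%:Z - K%:Z) != 0 :> padic p.
  rewrite -padic_abs_eq0 padic_abs_expz_natp // lt0r_neq0 // exprz_gt0 //.
  exact: lt_trans ltr01 (natp_gt1 p_prime).
have apN : 0 < padic_abs (p%:R ^ (n%:Z - K%:Z) : padic p) by case: (padic_absE pN0).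
apply/seteqP; split=> [x px|_ [z z1 <-]] /=; last first.
  by apply: (periods_abs_le pn); rewrite padic_absM ger_pMr.
exists (x / p%:R ^ (n%:Z - K%:Z)); last by rewrite mulrC divfK.
rewrite /padic_integers /= -(ler_pM2r apN) -padic_absM divfK // mul1r.
have [->|x0] := eqVneq x 0; first by rewrite padic_abs0 ltW.
have [w xw] := padic_abs_eq_expz x0.
rewrite leNgt; apply/negP; rewrite xw padic_abs_expz_natp //.
rewrite ltNge ler_eXz2l ?natp_gt1 // -ltNge => lt_w.
(* A period outside the ball has absolute value at least [p] times the radius, as values are powers
   of [p]; so the previous power of [p] would be a period too. *)
suff /n_min : P n.-1 by rewrite leqNgt prednK ?leqnn.
apply/asboolP/(periods_abs_le px); rewrite xw padic_abs_expz_natp //.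
rewrite ler_eXz2l ?natp_gt1 // -subn1 -subzn // opprB opprB addrA addrAC -opprB.
by rewrite -lezD1 in lt_w.
Qed.

End Periods.


Theorem corollary2p3 (R : realType) (p : nat) (p_prime : prime p)
    (Y : metricType R) (f : padic p -> Y) (f_cont : continuous f) :
  (~ is_constant f ->
     periods f = [set 0] \/
     exists N : int,
       periods f = [set (p%:R : padic p) ^ N * z | z in padic_integers p]) /\
  (is_constant f <->
     exists h : nat -> padic p,
       (forall n, periods f (h n)) /\ ~ padic_bounded (range h)).
Proof.
split=> [ncst|].
  have [[h ph h0]|none] := pselect (exists2 h, periods f h & h != 0).
    by right; exact: periods_ball ph h0.
  left; apply/seteqP; split=> [h ph|_ ->] /=; last by move=> x; rewrite addr0.
  by apply/eqP/negPn/negP => h0; apply: none; exists h.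
split=> [[c fc]|[h [ph unb]]].
  (* Every element is a period of a constant map, and these have absolute values [p ^ n]. *)
  exists (fun n => p%:R ^ (- n%:Z)); split=> [n x|[M bound]]; first by rewrite !fc.
  have [k] := expz_natp_gt p_prime M; apply/negP; rewrite -leNgt.
  by have := bound _ (ex_intro2 _ _ k I erefl); rewrite padic_abs_expz_natp // opprK.
apply: unbounded_periods_constant => // M; apply: contrapT => nM.
apply: unb; exists M => _ [n _ <-].
by rewrite leNgt; apply/negP => Mn; apply: nM; exists (h n).
Qed.
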